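(* For every $k\geq 1$, the hypercube graph $Q_k$ satisfies $F_d(Q_k)=Z(Q_k)=2^{k-1}$.
   Context: The hypercube $Q_k$ of dimension $k$ has vertex set $\{0,1\}^k$, with two vertices adjacent when they differ in exactly one coordinate. Zero forcing: given a set $B\subseteq V(G)$ of initially black vertices (all others white) of a finite simple graph $G$, at each step a black vertex having exactly one white neighbor forces that neighbor to become black; $B$ is a zero forcing set of $G$ if repeated application of this rule turns all vertices black. $Z(G)$ is the minimum cardinality of a zero forcing set. A set $D\subseteq V(G)$ is dominating if every vertex of $G$ is in $D$ or adjacent to a vertex of $D$. A dom-forcing set of $G$ is a set $D_f\subseteq V(G)$ that is both a dominating set of $G$ and a zero forcing set of $G$; the dom-forcing number $F_d(G)$ is the minimum cardinality of a dom-forcing set. *)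

(* Defs.v *)
From mathcomp Require Import all_boot.

Set Implicit Arguments.
Unset Strict Implicit.
Unset Printing Implicit Defensive.

Record sgraph := SGraph {
  vertex :> finType;
  adj : rel vertex;
  adj_sym : symmetric adj;
  adj_irrefl : irreflexive adj
}.
Arguments adj {s} x y.

Section DomForcing.
Variable G : sgraph.
Implicit Types (B D : {set G}) (u v w : G).

Definition white_nbrs B u : {set G} := [set v | adj u v & v \notin B].

(* One application of the rule; [B] is the set of black vertices. *)
Definition force_step : rel {set G} := fun B B' =>
  [exists u in B, exists w, (white_nbrs B u == [set w]) && (B' == w |: B)].

(* [connect] is the reflexive transitive closure, here on sets of vertices. *)
Definition zero_forcing B : bool := connect force_step B [set: G].

Definition dominating D : bool := [forall v, (v \in D) || [exists u in D, adj v u]].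

Definition dom_forcing D : bool := dominating D && zero_forcing D.

Lemma zero_forcing_setT : zero_forcing [set: G].
Proof. exact: connect0. Qed.

Lemma dom_forcing_setT : dom_forcing [set: G].
Proof.
by rewrite /dom_forcing zero_forcing_setT andbT; apply/forallP=> v; rewrite inE.
Qed.

(* [set: G] satisfies both predicates, so these are genuine minima. *)
Definition zf_number : nat :=
  #|[arg min_(B < [set: G] | zero_forcing B) #|B|]|.

Definition df_number : nat :=
  #|[arg min_(D < [set: G] | dom_forcing D) #|D|]|.

Lemma zf_numberP :
  (exists2 B, zero_forcing B & #|B| = zf_number) /\
  (forall B, zero_forcing B -> zf_number <= #|B|).
Proof.
rewrite /zf_number; case: arg_minnP => [|B zfB minB]; first exact: zero_forcing_setT.
by split; [exists B | apply: minB].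
Qed.

Lemma df_numberP :
  (exists2 D, dom_forcing D & #|D| = df_number) /\
  (forall D, dom_forcing D -> df_number <= #|D|).
Proof.
rewrite /df_number; case: arg_minnP => [|D dfD minD]; first exact: dom_forcing_setT.
by split; [exists D | apply: minD].
Qed.

End DomForcing.

Section Hypercube.
Variable k : nat.

Definition cube_vertex := {ffun 'I_k -> bool}.

Definition cube_adj : rel cube_vertex := fun x y => #|[set i | x i != y i]| == 1.

Lemma cube_adj_sym : symmetric cube_adj.
Proof.
move=> x y; congr (#|pred_of_set _| == 1).
by apply/setP=> i; rewrite !inE eq_sym.
Qed.

Lemma cube_adj_irrefl : irreflexive cube_adj.
Proof.
move=> x; rewrite /cube_adj; suff -> : [set i | x i != x i] = set0 by rewrite cards0.
by apply/setP=> i; rewrite !inE eqxx.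
Qed.

Definition hypercube : sgraph := SGraph cube_adj_sym cube_adj_irrefl.

End Hypercube.

(* Main.v *)
(** Lower bound: if a linear operator [M] on the functions on [G] is the adjacency
    operator plus a diagonal one, then a function in its kernel that vanishes on
    a zero forcing set vanishes everywhere (each force isolates one unknown in a
    linear equation), so [Z(G)] is at least the nullity of [M].  On [Q_k] over
    [F_2] let [T_i] flip coordinate [i] and take [M = \sum_i (1 + T_i)].  As the
    [T_i] are commuting involutions, [M^2 = \sum_i (1 + T_i)^2 = 0] in
    characteristic 2, so the nullity of [M] is at least [2^k / 2].
    Upper bound: a facet dominates [Q_k], and each of its vertices forces its only
    neighbour outside the facet. *)
From HB Require Import structures.
Require Import Defs.
From mathcomp Require Import all_boot all_algebra.

Set Implicit Arguments.
Unset Strict Implicit.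
Unset Printing Implicit Defensive.

Import GRing.Theory.

Section Nullity.
Local Open Scope ring_scope.
Variables (G : sgraph) (F : fieldType) (d : G -> F).
Variable M : 'End({ffun G -> F^o}).
Hypothesis ME : forall v u, M v u = d u * v u + \sum_(w | adj u w) v w.

Lemma force_kernel_eq0 (B B' : {set G}) v :
  force_step B B' -> M v = 0 ->
  {in B, forall u, v u = 0} -> {in B', forall u, v u = 0}.
Proof.
case/existsP=> u /andP[uB /existsP[w /andP[/eqP whw /eqP->]]] Mv0 vB0 x.
case/setU1P=> [->|/vB0 //].
have: w \in white_nbrs B u by rewrite whw set11.
rewrite inE => /andP[uw wB].
(* Every neighbour of [u] other than [w] is black, so the equation [M v u = 0] reduces to
   [v w = 0]. *)
have := ME v u; rewrite Mv0 ffunE vB0 // mulr0 add0r (bigD1 w) //=.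
rewrite big1 ?addr0 // => y /andP[uy yw]; apply: vB0.
apply: contraNT yw => yB.
by rewrite -in_set1 -whw inE uy.
Qed.

Lemma zero_forcing_kernel_eq0 (B : {set G}) v :
  zero_forcing B -> M v = 0 -> {in B, forall u, v u = 0} -> v = 0.
Proof.
case/connectP=> p; elim: p B => [|B' p IHp] B /= => [_ <- _ v0|].
  by apply/ffunP=> u; rewrite ffunE v0 ?inE.
case/andP=> BB' pB' lastT Mv0 vB0.
exact: IHp pB' lastT Mv0 (force_kernel_eq0 BB' Mv0 vB0).
Qed.

(** Restriction to [B] is injective on [lker M], so the kernel embeds in a space of dimension
    [#|B|]. *)
Lemma nullity_le_zero_forcing (B : {set G}) :
  zero_forcing B -> (\dim (lker M) <= #|B|)%N.
Proof.
move=> zfB.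
pose r (v : {ffun G -> F^o}) : {ffun {u | u \in B} -> F^o} := [ffun u => v (val u)].
have lin_r : linear r by move=> a v w; apply/ffunP=> u; rewrite !ffunE.
pose rL := GRing.isLinear.Build _ _ _ _ r lin_r.
pose rh : {linear _ -> _} := HB.pack r rL.
have <- : (\dim (linfun rh @: lker M))%VS = \dim (lker M).
  apply/limg_dim_eq/eqP; rewrite -subv0; apply/subvP=> v.
  rewrite memv_cap !memv_ker lfunE /= memv0 => /andP[/eqP Mv0 /eqP rv0].
  apply/eqP/(zero_forcing_kernel_eq0 zfB Mv0) => u uB.
  by move/ffunP/(_ (Sub u uB)): rv0; rewrite !ffunE.
apply: leq_trans (dimvS (subvf _)) _.
by rewrite dimvf /dim /= muln1 card_sig.
Qed.

End Nullity.

Section Flip.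
Variable k : nat.
Implicit Types (x y : hypercube k) (i j : 'I_k).

(** Translation by the [i]-th basis vector of the group of bit vectors. *)
Definition flip i x : hypercube k := [ffun j => x j (+) (j == i)].

Lemma flipK i : involutive (flip i).
Proof. by move=> x; apply/ffunP=> j; rewrite !ffunE addbK. Qed.

Lemma flipC i j x : flip i (flip j x) = flip j (flip i x).
Proof. by apply/ffunP=> l; rewrite !ffunE addbAC. Qed.

Lemma flip_inj x : injective (flip^~ x).
Proof.
by move=> i j /ffunP/(_ i); rewrite !ffunE eqxx => /addbI/esym/eqP.
Qed.

Lemma adj_flip x y : adj x y = (y \in [set flip i x | i : 'I_k]).
Proof.
rewrite /adj /= /cube_adj; apply/cards1P/imsetP=> [[i di]|[i _ ->]]; exists i => //.
  apply/ffunP=> j; rewrite ffunE -in_set1 -di inE.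
  by case: (x j); case: (y j).
by apply/setP=> j; rewrite !inE ffunE; case: (x j); case: (j == i).
Qed.

Lemma sum_adj_flip (V : nmodType) x (v : hypercube k -> V) :
  (\sum_(y | adj x y) v y = \sum_i v (flip i x))%R.
Proof.
rewrite (eq_bigl _ _ (adj_flip x)) big_imset /=; last by move=> i j _ _ /flip_inj.
by apply: eq_bigl => i; rewrite inE.
Qed.

End Flip.

Section LowerBound.
Local Open Scope ring_scope.

(** The terms at [(i, j)] and [(j, i)] cancel in characteristic 2, and the diagonal contributes
    nothing. *)
Lemma sum_sym_pchar2 (R : nzRingType) (n : nat) (a : 'I_n -> 'I_n -> R) :
  2%N \in [pchar R] -> (forall i, a i i = 0) -> (forall i j, a i j = a j i) ->
  \sum_i \sum_j a i j = 0.
Proof.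
move=> charR a0 aC.
pose s := \sum_(i < n) \sum_(j < n | (i < j)%N) a i j.
have sE : s = \sum_(i < n) \sum_(j < n | (j < i)%N) a i j.
  rewrite /s (exchange_big_dep xpredT) //=.
  by apply: eq_bigr => i _; apply: eq_bigr => j _.
have -> : \sum_i \sum_j a i j = s + s; last by rewrite addrr_pchar2.
rewrite {2}sE /s -big_split; apply: eq_bigr => i _ /=.
rewrite (bigID (fun j : 'I_n => i < j)%N) /=; congr (_ + _).
rewrite (bigD1 i) ?ltnn //= a0 add0r; apply: eq_bigl => j.
by rewrite -leqNgt ltn_neqAle andbC.
Qed.

Variable k : nat.
Notation V := {ffun hypercube k -> ('F_2)^o}.

(** Keeping each [1 + T_i] grouped makes the square a double sum that is visibly symmetric;
    [flip_sumE] recovers the form adjacency plus diagonal. *)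
Definition flip_sum (v : V) : V := [ffun x => \sum_i (v x + v (flip i x))].

Lemma flip_sum_linear : linear flip_sum.
Proof.
move=> a v w; apply/ffunP=> x; rewrite !ffunE scaler_sumr -big_split.
by apply: eq_bigr => i _; rewrite !ffunE scalerDr addrACA.
Qed.

HB.instance Definition _ :=
  GRing.isLinear.Build 'F_2 V V _ flip_sum flip_sum_linear.

Lemma flip_sumE (v : V) x :
  flip_sum v x = k%:R * v x + \sum_(y | adj x y) v y.
Proof.
by rewrite ffunE big_split sum_adj_flip sumr_const card_ord mulr_natl.
Qed.

Lemma flip_sum_sqr0 (v : V) : flip_sum (flip_sum v) = 0.
Proof.
have char2 : 2%N \in [pchar 'F_2] by exact: pchar_Fp.
apply/ffunP=> x; rewrite !ffunE.
under eq_bigr => i _ do rewrite !ffunE -big_split.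
(* The summand is [(1 + T_i)(1 + T_j)] applied to [v] at [x]: zero for [i = j] as [T_i] is an
   involution, symmetric as the flips commute. *)
apply: (sum_sym_pchar2 char2) => [i|i j] /=.
  by rewrite flipK [v x + _]addrC addrr_pchar2.
by rewrite flipC addrACA.
Qed.

Lemma card_cube_le_nullity : (2 ^ k <= (\dim (lker (linfun flip_sum))).*2)%N.
Proof.
have -> : (2 ^ k)%N = \dim {: V}.
  by rewrite dimvf /dim /= muln1 card_ffun card_bool card_ord.
(* By rank-nullity it remains to bound the rank by the nullity, and the image lies in the kernel
   because the square is zero. *)
rewrite -(limg_ker_dim (linfun flip_sum) fullv) capfv -addnn leq_add2l.
apply/dimvS/subvP=> _ /memv_imgP[v _ ->].
by rewrite memv_ker !lfunE /= flip_sum_sqr0.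
Qed.

Lemma zero_forcing_cube_ge (B : {set hypercube k}) :
  zero_forcing B -> (2 ^ k <= #|B|.*2)%N.
Proof.
move=> zfB; apply: leq_trans card_cube_le_nullity _; rewrite leq_double.
apply: (@nullity_le_zero_forcing _ _ (fun=> k%:R)) zfB => v u.
by rewrite lfunE flip_sumE.
Qed.

End LowerBound.

Section Facet.
Variables (k : nat) (i : 'I_k).

Definition facet : {set hypercube k} := [set x : hypercube k | ~~ x i].

Lemma flip_facet x : (flip i x \in facet) = (x \notin facet).
Proof. by rewrite !inE ffunE eqxx addbT. Qed.

Lemma adj_facet x y : x \in facet -> y \notin facet -> adj x y = (y == flip i x).
Proof.
rewrite !inE negbK adj_flip => xi yi; apply/imsetP/eqP=> [[j _ yE]|->]; last by exists i.
by move: yi; rewrite yE ffunE (negPf xi) => /eqP->.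
Qed.

(** Flipping coordinate [i] exchanges the facet with its complement. *)
Lemma card_facet : #|facet|.*2 = 2 ^ k.
Proof.
have <- : #|{: hypercube k}| = 2 ^ k by rewrite card_ffun card_bool card_ord.
rewrite -(cardsC facet) -addnn; congr (_ + _).
rewrite -(card_imset _ (inv_inj (@flipK k i))).
apply: eq_card => x; rewrite -[x](@flipK k i) (mem_imset _ _ (inv_inj (@flipK k i))).
by rewrite in_setC flip_facet flipK.
Qed.

Lemma facet_dominating : dominating facet.
Proof.
apply/forallP=> v; case: (boolP (v \in facet)) => // vN; rewrite orFb.
apply/existsP; exists (flip i v); rewrite flip_facet vN.
by rewrite adj_flip; apply/imsetP; exists i.
Qed.

(** Stated for all supersets of the facet so that induction on the number of white vertices can
    blacken them one at a time. *)
Lemma zero_forcing_facetU (B : {set hypercube k}) : facet \subset B -> zero_forcing B.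
Proof.
move: {2}#|~: B| (leqnn #|~: B|) => n; elim: n B => [|n IHn] B.
  rewrite leqn0 cards_eq0 => /eqP BC0 _.
  by rewrite -[B]setCK BC0 setC0 zero_forcing_setT.
move=> leBn sFB; have [BT|[w]] := set_0Vmem (~: B).
  by rewrite -[B]setCK BT setC0 zero_forcing_setT.
rewrite inE => wB; have wF : w \notin facet by apply: contra wB => /(subsetP sFB).
have uF : flip i w \in facet by rewrite flip_facet.
apply: (@connect_trans _ _ (w |: B)).
  (* The forcing vertex [flip i w] lies in the facet, and [w] is its only neighbour outside, hence
     its only white one. *)
  apply/connect1/existsP; exists (flip i w); rewrite (subsetP sFB) //=.
  apply/existsP; exists w; rewrite eqxx andbT; apply/eqP/setP=> y.
  rewrite !inE; have [yB|yB] := boolP (y \in B).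
    by rewrite andbF; apply/esym; apply: contraNF wB => /eqP <-.
  rewrite andbT adj_facet ?flipK //.
  by apply: contra yB => /(subsetP sFB).
apply: IHn; last exact: subset_trans sFB (subsetUr _ _).
rewrite -ltnS; apply: leq_trans leBn; apply: proper_card.
rewrite setCU properE subsetIr /=; apply/subsetPn; exists w;
  by rewrite !inE ?eqxx.
Qed.

End Facet.

Theorem theorem3p3 (k : nat) (hk : 1 <= k) :
  df_number (hypercube k) = zf_number (hypercube k) /\
  zf_number (hypercube k) = 2 ^ (k - 1).
Proof.
have k2 : 2 ^ k = (2 ^ (k - 1)).*2 by rewrite -mul2n -expnS subn1 prednK.
have zf_ge (B : {set hypercube k}) : zero_forcing B -> 2 ^ (k - 1) <= #|B|.
  by move/zero_forcing_cube_ge; rewrite k2 leq_double.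
(* The bound [1 <= k] supplies coordinate 0, which defines the facet. *)
pose B := facet (Ordinal hk).
have cardB : #|B| = 2 ^ (k - 1) by apply: double_inj; rewrite card_facet k2.
have zfB : zero_forcing B by exact: (zero_forcing_facetU (i := Ordinal hk)).
have dfB : dom_forcing B by rewrite /dom_forcing facet_dominating zfB.
have [[Z zfZ cardZ] minZ] := zf_numberP (hypercube k).
have [[D dfD cardD] minD] := df_numberP (hypercube k).
have zfE : zf_number (hypercube k) = 2 ^ (k - 1).
  by apply: anti_leq; rewrite -{1}cardB (minZ B) //= -cardZ; apply: zf_ge.
split=> //; rewrite zfE; apply: anti_leq; rewrite -{1}cardB (minD B) //= -cardD.
by case/andP: dfD => _ /zf_ge.
Qed.
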